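(* Let $\bar\tau\in\mathbb{N}_0$, let $p,q\in(0,1)$ satisfy $p+q<1$, and let $\{V(k)\}_{k\in\mathbb{N}_0}$ be a non-negative real sequence such that for all $k\in\mathbb{N}_0$ $$V(k+1)\le p\,V(k)+q\max_{\max(0,k-\bar\tau)\le\ell\le k}V(\ell).$$ Then $$V(k)\le\rho^k\,V(0)\quad\text{for all }k\in\mathbb{N}_0,\qquad\text{where}\quad \rho=(p+q)^{\frac{1}{1+(1-p)\bar\tau}}.$$
   Context: $\mathbb{N}_0=\{0,1,2,\dots\}$; in the maximum, $\ell$ ranges over integers. *)

(* Defs.v *)
From mathcomp Require Import all_boot all_order all_algebra.
From mathcomp Require Import reals exp.

Set Implicit Arguments.
Unset Strict Implicit.
Unset Printing Implicit Defensive.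

Import Order.TTheory GRing.Theory Num.Theory.

Local Open Scope ring_scope.

(* Truncated subtraction makes (k - tau)%N equal to max(0, k - tau).  The default
   V k is itself a term of the range, so it does not affect the maximum. *)
Definition delayed_max (R : realType) (V : nat -> R) (tau k : nat) : R :=
  \big[Num.max/V k]_((k - tau)%N <= l < k.+1) V l.

(* Main.v *)
Require Import Defs.
From mathcomp Require Import all_boot all_order all_algebra.
From mathcomp Require Import reals exp.
From mathcomp Require Import lra.

Set Implicit Arguments.
Unset Strict Implicit.
Unset Printing Implicit Defensive.

Import Order.TTheory GRing.Theory Num.Theory.

Local Open Scope ring_scope.

(** A geometric sequence of ratio [r <= 1] is decreasing, so its maximum over
    the delay window is attained at the oldest index.  It therefore dominates
    every solution of the recursion as soon as [p + q r ^ (- tau) <= r]; cleared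
    of denominators this reads [q <= r ^ tau (r - p)] ([geometric_bound]).

    It remains to check this characteristic inequality for [r = rho]
    ([characteristic_ineq]).  Put [u = rho ^ tau].  The exponent defining [rho]
    is chosen so that [p + q = rho u ^ (1 - p)], and Bernoulli's inequality
    [u ^ (1 - p) <= (1 - p) u + p] gives [p + q <= rho ((1 - p) u + p)].  Since
    [p + u (rho - p) - rho ((1 - p) u + p) = p (1 - rho) (1 - u) >= 0],
    the inequality [p + q <= p + u (rho - p)] follows. *)

(** Bernoulli's inequality for an exponent in (0, 1): it is Young's inequality
    with exponents [1 / e] and [1 / (1 - e)] for the pair [(u ^ e, 1)]. *)
Lemma powR_le_chord (R : realType) (e u : R) :
  0 < e -> e < 1 -> 0 <= u -> u `^ e <= e * u + (1 - e).
Proof.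
move=> e0 e1 u0; have e'0 : 0 < 1 - e by rewrite subr_gt0.
have := @conjugate_powR R (u `^ e) 1 e^-1 (1 - e)^-1.
rewrite powR1 mulr1 -powRrM divff ?gt_eqF// powRr1// !invrK mul1r [u * e]mulrC.
by apply => //; rewrite ?powR_ge0 ?invr_gt0//; lra.
Qed.

Lemma characteristic_ineq (R : realType) (tau : nat) (p q : R) :
  0 < p -> p < 1 -> 0 < p + q <= 1 ->
  let rho := (p + q) `^ (1 / (1 + (1 - p) * tau%:R)) in
  [/\ 0 < rho, rho <= 1 & q <= rho ^+ tau * (rho - p)].
Proof.
move=> p0 p1 /andP[s0 s1] rho.
set d := 1 + (1 - p) * tau%:R in rho *.
have d0 : 0 < d by rewrite ltr_pwDl// mulr_ge0// subr_ge0 ltW.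
have rho_gt0 : 0 < rho by exact: powR_gt0.
have rho_le1 : rho <= 1.
  by rewrite -(powRr0 (p + q)) ger_powR ?s0// divr_ge0// ltW.
split=> //; set u := rho ^+ tau.
have u0 : 0 < u by exact: exprn_gt0.
have u1 : u <= 1 by rewrite exprn_ile1// ltW.
have sE : p + q = rho * u `^ (1 - p).
  rewrite /u -powR_mulrn ?(ltW rho_gt0)// -powRrM mulrC.
  rewrite -[X in _ * X](powRr1 (ltW rho_gt0)).
  rewrite -powRD ?(gt_eqF rho_gt0) ?implybT//.
  rewrite [_ + 1]addrC [tau%:R * _]mulrC -/d /rho -powRrM.
  by rewrite mul1r mulVf ?gt_eqF// powRr1// ltW.
have : u `^ (1 - p) <= (1 - p) * u + (1 - (1 - p)).
  by apply: powR_le_chord; lra.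
move=> /(ler_wpM2l (ltW rho_gt0)); rewrite -sE => sle.
have : 0 <= p * ((1 - rho) * (1 - u)).
  by rewrite mulr_ge0 ?(ltW p0)// mulr_ge0// subr_ge0.
lra.
Qed.

Lemma delayed_max_le (R : realType) (V : nat -> R) (tau k : nat) (M : R) :
  (forall l, (k - tau <= l <= k)%N -> V l <= M) -> delayed_max V tau k <= M.
Proof.
move=> VM; rewrite /delayed_max big_nat; apply: bigmax_le => [|l].
  by rewrite VM// leq_subr leqnn.
by rewrite ltnS; exact: VM.
Qed.

(** Comparison with the geometric supersolution, by strong induction. *)
Lemma geometric_bound (R : realType) (tau : nat) (p q r : R) (V : nat -> R) :
  0 <= p -> 0 < q -> 0 < r -> r <= 1 -> q <= r ^+ tau * (r - p) ->
  0 <= V 0%N ->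
  (forall k, V k.+1 <= p * V k + q * delayed_max V tau k) ->
  forall k, V k <= r ^+ k * V 0%N.
Proof.
move=> p0 q0 r_gt0 r1 qr V0 V_rec; have r0 := ltW r_gt0.
have rp : 0 <= r - p.
  by rewrite -(pmulr_rge0 _ (exprn_gt0 tau r_gt0)) (le_trans (ltW q0)).
elim/ltn_ind=> -[_|k IH]; first by rewrite mul1r.
have max_le : delayed_max V tau k <= r ^+ (k - tau) * V 0%N.
  apply: delayed_max_le => l /andP[kl lk].
  apply: le_trans (IH l _) _; first by rewrite ltnS.
  by rewrite ler_wpM2r// ler_wiXn2l.
have qk : q * r ^+ (k - tau) <= r ^+ k * (r - p).
  (* For [k < tau] the truncated [k - tau] is 0, so [tau + (k - tau)] exceeds
     [k]; as [r <= 1], this only makes the power smaller. *)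
  apply: (@le_trans _ _ (r ^+ (tau + (k - tau)) * (r - p))).
    by rewrite exprD mulrAC ler_wpM2r// exprn_ge0.
  by rewrite ler_wpM2r// ler_wiXn2l// -leq_subLR.
apply: le_trans (V_rec k) _.
apply: (@le_trans _ _ ((p * r ^+ k + q * r ^+ (k - tau)) * V 0%N)).
  by rewrite mulrDl -!mulrA lerD// ler_wpM2l ?IH// ltW.
rewrite ler_wpM2r// exprSr; lra.
Qed.

Theorem lemma9 (R : realType) (tau : nat) (p q : R) (V : nat -> R)
    (hp0 : 0 < p) (hp1 : p < 1) (hq0 : 0 < q) (hq1 : q < 1) (hpq : p + q < 1)
    (V_ge0 : forall k : nat, 0 <= V k)
    (V_rec : forall k : nat, V k.+1 <= p * V k + q * delayed_max V tau k) :
  let rho : R := (p + q) `^ (1 / (1 + (1 - p) * tau%:R)) in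
  forall k : nat, V k <= rho ^+ k * V 0%N.
Proof.
have s01 : 0 < p + q <= 1 by rewrite addr_gt0// ltW.
have [rho_gt0 rho_le1 q_le] := characteristic_ineq tau hp0 hp1 s01.
exact: geometric_bound (ltW hp0) hq0 rho_gt0 rho_le1 q_le (V_ge0 0%N) V_rec.
Qed.
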